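(* Let $A=A^\top\in\mathbb{R}^{n\times n}$ be such that the undirected graph $\mathcal{G}(A)$ is a tree, and let $B=\mathbf{e}_1\in\mathbb{R}^n$ (so that node $1$ is the single leader and the nodes $2,\dots,n$ are the followers). Suppose that all the followers have distance one from the leader. Then the pair $(A,B)$ is herdable if and only if all the edges of $\mathcal{G}(A)$ have the same sign.
   Context: Graph of a matrix: for a symmetric $A\in\mathbb{R}^{n\times n}$, $\mathcal{G}(A)$ is the signed weighted undirected graph with node set $\{1,\dots,n\}$ and an edge between $j$ and $i$ if and only if $[A]_{ij}=[A]_{ji}\neq 0$, with weight (hence sign) that of $[A]_{ij}$. It is a tree if it is connected and acyclic (in particular without self-loops, so $A$ has zero diagonal). The distance between two nodes is the minimum number of edges of a walk joining them. $\mathbf{e}_1$ is the first canonical basis vector. Herdability: a pair $(A,B)$, $A\in\mathbb{R}^{n\times n}$, $B\in\mathbb{R}^{n\times m}$, describing the linear time-invariant (continuous-time or discrete-time) system $\dot{\mathbf x}=A\mathbf{x}+B\mathbf{u}$ or $\mathbf{x}(t+1)=A\mathbf{x}(t)+B\mathbf{u}(t)$, is herdable if for every $\mathbf{x}(0)$ and every $h>0$ there exist $t_f>0$ and an input $\mathbf{u}(t)$, $t\in[0,t_f)$, driving the state from $\mathbf{x}(0)$ to $\mathbf{x}(t_f)\ge h\mathbf{1}_n$ (entrywise). It is known that this is equivalent to the image of the controllability matrix $\mathcal{R}(A,B)=[B\ \ AB\ \ \cdots\ \ A^{n-1}B]$ containing a vector with all entries strictly positive. *)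

(* Defs.v *)
From HB Require Import structures.
From mathcomp Require Import all_boot all_order all_algebra.
From mathcomp Require Import all_classical all_reals all_analysis.

Set Implicit Arguments.
Unset Strict Implicit.
Unset Printing Implicit Defensive.

Import Order.TTheory GRing.Theory Num.Theory.
Import numFieldNormedType.Exports.

Local Open Scope classical_set_scope.
Local Open Scope ring_scope.

Section Graph.
Variables (T : finType) (e : rel T).

(* A cycle is a closed walk through pairwise distinct nodes.  Length 1 is a
   self-loop; length 2 merely traverses an undirected edge back and forth. *)
Definition graph_acyclic : Prop :=
  forall p : seq T, ucycle e p -> size p <> 1%N /\ ~ (2 < size p)%N.

Definition graph_connected : Prop := forall x y : T, connect e x y.

Definition is_tree : Prop := graph_connected /\ graph_acyclic.

Definition walk_between (x y : T) (p : seq T) : Prop :=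
  path e x p /\ last x p = y.

(* The walk x :: p has size p edges. *)
Definition at_distance (x y : T) (k : nat) : Prop :=
  (exists2 p, walk_between x y p & size p = k) /\
  (forall p, walk_between x y p -> (k <= size p)%N).

End Graph.

Section MatrixGraph.
Variables (R : realType) (n : nat) (A : 'M[R]_n).

(* A pair (i, i) is an edge (a self-loop) when A i i != 0. *)
Definition mx_graph : rel 'I_n := [rel i j | A i j != 0].

Definition edges_same_sign : Prop :=
  forall i j k l : 'I_n, mx_graph i j -> mx_graph k l ->
    Num.sg (A i j) = Num.sg (A k l).

End MatrixGraph.

Section Herdability.
Variables (R : realType) (n m : nat) (A : 'M[R]_n) (B : 'M[R]_(n, m)).

(* Admissible inputs are the Lebesgue integrable ones, and the differential
   equation x' = A x + B u is understood in the sense of Caratheodory: x is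
   continuous and satisfies the equation in integrated form.  The continuity
   of x makes the integrand integrable, so that the integral is genuine. *)
Definition ct_trajectory (tf : R) (x0 : 'cV[R]_n)
    (u : R -> 'cV[R]_m) (x : R -> 'cV[R]_n) : Prop :=
  [/\ forall j : 'I_m, (@lebesgue_measure R).-integrable `[0, tf[
        (fun t => (u t j 0)%:E),
      forall i : 'I_n, {within `[0, tf], continuous (fun t => x t i 0)} &
      forall (t : R) (i : 'I_n), 0 <= t <= tf ->
        x t i 0 = x0 i 0 +
          \int[@lebesgue_measure R]_(s in `[0, t[) (A *m x s + B *m u s) i 0].

Definition herdable_ct : Prop :=
  forall (x0 : 'cV[R]_n) (h : R), 0 < h ->
  exists (tf : R) (u : R -> 'cV[R]_m) (x : R -> 'cV[R]_n),
    [/\ 0 < tf, ct_trajectory tf x0 u x & forall i : 'I_n, h <= x tf i 0].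

Definition dt_trajectory (tf : nat) (x0 : 'cV[R]_n)
    (u : nat -> 'cV[R]_m) (x : nat -> 'cV[R]_n) : Prop :=
  x 0%N = x0 /\
  (forall t : nat, (t < tf)%N -> x t.+1 = A *m x t + B *m u t).

Definition herdable_dt : Prop :=
  forall (x0 : 'cV[R]_n) (h : R), 0 < h ->
  exists (tf : nat) (u : nat -> 'cV[R]_m) (x : nat -> 'cV[R]_n),
    [/\ (0 < tf)%N, dt_trajectory tf x0 u x & forall i : 'I_n, h <= x tf i 0].

End Herdability.

(* Main.v *)
Require Import Defs.
From HB Require Import structures.
From mathcomp Require Import all_boot all_order all_algebra.
From mathcomp Require Import all_classical all_reals all_analysis.
From mathcomp Require Import ring lra.

(** The tree is a star centred at the leader.  With [A i 0 = a_i], every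
    follower satisfies [x_i' = a_i x_0] (respectively [x_i(t+1) = a_i x_0(t)]),
    so from the origin all followers are [a_i c] for one common real [c], the
    integral (respectively the last value) of the leader's state; they can all
    be positive only if the [a_i] have the same sign.  Conversely the input acts
    directly on the leader, whose trajectory can thus be prescribed: any value
    of [c] is reached together with any final value of the leader. *)

Set Implicit Arguments.
Unset Strict Implicit.
Unset Printing Implicit Defensive.

Import Order.TTheory GRing.Theory Num.Theory.
Import numFieldNormedType.Exports.
Local Open Scope classical_set_scope.
Local Open Scope ring_scope.

Lemma within_continuous_horner (R : realType) (p : {poly R}) (D : set R) :
  {within D, continuous (horner p)}.
Proof. by apply: continuous_subspaceT; exact: continuous_horner. Qed.

Lemma within_continuous_integrable (R : realType) (f : R -> R) (a b t : R) :
  t <= b -> {within `[a, b], continuous f} ->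
  (@lebesgue_measure R).-integrable `[a, t[ (EFin \o f).
Proof.
move=> tb cf.
have := continuous_compact_integrable (@segment_compact _ a b) cf.
by apply: integrableS => //; apply: subset_itvl; rewrite bnd_simp.
Qed.

Lemma Rintegral_deriv (R : realType) (p : {poly R}) (t : R) : 0 <= t ->
  \int[@lebesgue_measure R]_(s in `[0, t[) (p^`()).[s] = p.[t] - p.[0].
Proof.
(* The fundamental theorem of calculus needs a nondegenerate interval, so [t = 0] is treated
   apart. *)
rewrite le_eqVlt => /predU1P[<-|t0].
  by rewrite set_itv_ge ?bnd_simp ?ltxx// Rintegral_set0 subrr.
rewrite Rintegral_itv_bndo_bndc; last first.
  exact: (within_continuous_integrable (lexx t)
    (@within_continuous_horner _ p^`() _)).
rewrite /Rintegral (@continuous_FTC2 _ _ (horner p))//.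
- exact: within_continuous_horner.
- split=> [x _| |].
  + exact: derivable_horner.
  + by apply: cvg_at_right_filter; exact: continuous_horner.
  + by apply: cvg_at_left_filter; exact: continuous_horner.
- by move=> x _; rewrite derivE.
Qed.

(** For states and inputs polynomial in time, the differential equation is an identity in
    [{poly R}]; its integrated form follows by the fundamental theorem of calculus. *)
Lemma ct_trajectory_poly (R : realType) (n m : nat) (A : 'M[R]_n)
    (B : 'M[R]_(n, m)) (tf : R) (x0 : 'cV[R]_n)
    (X : 'I_n -> {poly R}) (U : 'I_m -> {poly R}) :
  (forall i, (X i).[0] = x0 i 0) ->
  (forall i, \sum_j A i j *: X j + \sum_k B i k *: U k = (X i)^`()) ->
  ct_trajectory A B tf x0 (fun t => \col_k (U k).[t]) (fun t => \col_i (X i).[t]).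
Proof.
move=> X0 dX; split=> [k|i|t i /andP[t0 _]].
- rewrite (_ : (fun t => _) = EFin \o horner (U k)); last first.
    by apply/funext => t /=; rewrite mxE.
  exact: (within_continuous_integrable (lexx tf)
    (@within_continuous_horner _ (U k) _)).
- rewrite (_ : (fun t => _) = horner (X i)); last first.
    by apply/funext => t; rewrite mxE.
  exact: within_continuous_horner.
- rewrite mxE -X0.
  rewrite (_ : (fun s => _) = (fun s => (X i)^`().[s])); last first.
    apply/funext => s; rewrite -dX hornerD !horner_sum !mxE.
    by congr (_ + _); apply: eq_bigr => j _; rewrite !mxE hornerZ.
  by rewrite Rintegral_deriv// addrC subrK.
Qed.

(** [P] will be the primitive of the leader's state: [p] and [q] are the leader's values at times 0
    and 1, and [c] is its integral. *)
Lemma cubic_hermite_interpolation (R : realType) (p q c : R) :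
  exists P : {poly R},
    [/\ P.[0] = 0, P.[1] = c, (P^`()).[0] = p & (P^`()).[1] = q].
Proof.
(* Solution of [p + c2 + c3 = c] and [p + 2 * c2 + 3 * c3 = q]. *)
pose c3 := p + q - 2 * c; pose c2 := 3 * c - 2 * p - q.
exists (p *: 'X + c2 *: 'X^2 + c3 *: 'X^3); rewrite /c2 /c3.
by split; rewrite ?(derivD, derivZ, derivX, derivXn) !hornerE /=; ring.
Qed.

Section Star.
Variables (R : realType) (n : nat) (A : 'M[R]_n.+1).

Definition star_mx : Prop :=
  [/\ A = A^T, A 0 0 = 0, forall i, i != 0 -> A i 0 != 0 &
      forall i j, i != 0 -> j != 0 -> A i j = 0].

(** A nonzero diagonal entry is a cycle of length one, and an edge between two followers closes a
    triangle through the leader. *)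
Lemma tree_star_mx : A = A^T -> is_tree (mx_graph A) ->
  (forall i, i != 0 -> at_distance (mx_graph A) 0 i 1) -> star_mx.
Proof.
move=> hsym [_ acyc] dist1.
have symA i j : A i j = A j i by rewrite {1}hsym mxE.
have edgeE i j : mx_graph A i j = (A i j != 0) by [].
have A0 i : A i i = 0.
  apply/eqP/negP => /negP Aii.
  have cyc : ucycle (mx_graph A) [:: i] by rewrite /ucycle /= edgeE Aii.
  by have [] := acyc _ cyc.
have Ai0 i : i != 0 -> A i 0 != 0.
  move=> /dist1[[p [+ +] +] _].
  case: p => [|y [|]]//= /andP[A0y _] <- _.
  by rewrite symA.
split=> // i j i0 j0; apply/eqP/negP => /negP Aij.
have [ij|ij] := eqVneq i j; first by rewrite ij A0 eqxx in Aij.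
have cyc : ucycle (mx_graph A) [:: 0; i; j].
  rewrite /ucycle /= !edgeE Aij (symA 0 i) !Ai0//=.
  by rewrite !inE negb_or ![0 == _]eq_sym i0 j0 ij.
by have [] := acyc _ cyc.
Qed.

Lemma star_same_sign (c : R) : star_mx ->
  (forall i, i != 0 -> 0 < A i 0 * c) -> edges_same_sign A.
Proof.
move=> [hsym A00 _ Aij0] Ac.
have sgA i : i != 0 -> Num.sg (A i 0) = Num.sg c.
  (* Signs lie in {-1, 0, 1}, so a product equal to 1 forces both to agree. *)
  move=> /Ac Aic; have : Num.sg (A i 0) * Num.sg c = 1 by rewrite -sgrM gtr0_sg.
  by case: (sgrP (A i 0)); case: (sgrP c) => _ _ /eqP; lra.
have sgE i j : A i j != 0 -> Num.sg (A i j) = Num.sg c.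
  have [->|i0] := eqVneq i 0; have [->|j0] := eqVneq j 0.
  - by rewrite A00 eqxx.
  - by rewrite hsym mxE sgA.
  - by rewrite sgA.
  - by rewrite Aij0 ?eqxx.
by move=> i j k l /= /sgE-> /sgE->.
Qed.

(** A [c] of the common sign pushes every follower up from its offset [v i]; it only has to be large
    enough. *)
Lemma star_common_gain (v : 'I_n.+1 -> R) (h : R) : star_mx ->
  edges_same_sign A ->
  exists c, forall i, i != 0 -> h <= v i + A i 0 * c.
Proof.
move=> [_ _ Ai0 _] same.
have [s sA] : exists s, forall i, i != 0 -> Num.sg (A i 0) = s.
  case: (pickP [pred i : 'I_n.+1 | i != 0]) => [k k0|none].
    exists (Num.sg (A k 0)) => i i0; apply: same; exact: Ai0.
  (* Without followers any [s] will do. *)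
  by exists 0 => i; have /= -> := none i.
(* Since [A i 0 * s] is the absolute value of [A i 0], the [i]-th term alone already covers
   [h - v i]. The term at the leader divides by zero and is 0. *)
exists (s * \sum_j `|h - v j| / `|A j 0|) => i i0.
rewrite -(sA i i0) mulrA [A i 0 * _]mulrC -normrEsg -lerBlDl.
apply: le_trans (ler_norm _) _.
rewrite mulrC -ler_pdivrMr ?normr_gt0 ?Ai0//.
by rewrite (bigD1 i)//= lerDl sumr_ge0.
Qed.

Let B : 'cV[R]_n.+1 := delta_mx 0 0.

Lemma star_follower (x : 'cV[R]_n.+1) (u : 'cV[R]_1) i : star_mx -> i != 0 ->
  (A *m x + B *m u) i 0 = A i 0 * x 0 0.
Proof.
move=> [_ _ _ Aij0] i0; rewrite !mxE big_ord1 mxE (negbTE i0) mul0r addr0.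
by rewrite big_ord_recl big1 ?addr0// => j _; rewrite Aij0 ?mul0r.
Qed.

Lemma leader_input (x : 'cV[R]_n.+1) (c : R) :
  (A *m x + B *m const_mx (c - (A *m x) 0 0)) 0 0 = c.
Proof. by rewrite !mxE big_ord1 !mxE /= mul1r addrC subrK. Qed.

Lemma star_herdable_dt : star_mx -> herdable_dt A B <-> edges_same_sign A.
Proof.
move=> star; split=> [herd|same].
  have [tf [u [x [tf0 [_ xS] hx]]]] := herd 0 1 ltr01.
  case: tf tf0 xS hx => // t _ xS hx.
  apply: (@star_same_sign (x t 0 0)) => // i i0.
  by rewrite -(star_follower (x t) (u t))// -xS// (lt_le_trans ltr01).
move=> x0 h h0.
(* The offset is 0: a follower's next value depends on the leader only. The first step sets the
   leader to [c], the second sends the followers to [A i 0 * c] and the leader to [h]. *)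
have [c hc] := star_common_gain (fun=> 0) h star same.
pose ctl (y : 'cV[R]_n.+1) d : 'cV[R]_1 := const_mx (d - (A *m y) 0 0).
pose next y d := A *m y + B *m ctl y d.
pose x1 := next x0 c.
exists 2%N, (fun t => if t is 0%N then ctl x0 c else ctl x1 h),
  (fun t => match t with 0%N => x0 | 1%N => x1 | _ => next x1 h end).
split=> //; first by split=> // -[|[|]].
move=> i; have [->|i0] := eqVneq i 0; first by rewrite leader_input.
by rewrite star_follower// /x1 leader_input -[leRHS]add0r hc.
Qed.

Lemma star_herdable_ct : star_mx -> herdable_ct A B <-> edges_same_sign A.
Proof.
move=> star; split=> [herd|same].
  have [tf [u [x [tf0 [_ cx xE] hx]]]] := herd 0 1 ltr01.
  apply: (@star_same_sign
    (\int[@lebesgue_measure R]_(s in `[0, tf[) (x s 0 0))) => // i i0.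
  have := hx i; rewrite xE ?lexx ?(ltW tf0)// mxE add0r.
  rewrite (_ : (fun s => _) = (fun s => A i 0 * x s 0 0)); last first.
    by apply/funext => s; rewrite star_follower.
  rewrite RintegralZl//; first exact: lt_le_trans ltr01.
  exact: within_continuous_integrable (lexx tf) (cx 0).
move=> x0 h h0.
have [c hc] := star_common_gain (fun i => x0 i 0) h star same.
have [P [P0 P1 dP0 dP1]] := cubic_hermite_interpolation (x0 0 0) h c.
(* Followers integrate the leader's state from [x0]; the input [U] is what the leader's equation
   then requires, its derivative minus the coupling term. *)
pose X i := if i == 0 then P^`() else (x0 i 0)%:P + A i 0 *: P.
pose U : {poly R} := P^`()^`() - \sum_j A 0 j *: X j.
exists 1, (fun t => \col__ U.[t]), (fun t => \col_i (X i).[t]); split=> //.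
- apply: (@ct_trajectory_poly _ _ _ _ _ _ _ X (fun=> U)) => i.
    rewrite /X; case: eqP => [->//|_].
    by rewrite !hornerE P0 mulr0 addr0.
  rewrite big_ord1 mxE andbT; have [->|i0] := eqVneq i 0.
    by rewrite scale1r addrC subrK.
  have [_ _ _ Aij0] := star.
  rewrite scale0r addr0 big_ord_recl big1 => [|j _]; last first.
    by rewrite Aij0 ?scale0r.
  by rewrite /X eqxx (negbTE i0) derivD derivC derivZ add0r addr0.
- move=> i; rewrite mxE /X; case: eqVneq => [_|i0]; first by rewrite dP1.
  by rewrite !hornerE P1 hc.
Qed.

End Star.

Theorem proposition10 (R : realType) (n : nat) (A : 'M[R]_n.+1)
    (hsym : A = A^T)
    (htree : is_tree (mx_graph A))
    (hdist : forall i : 'I_n.+1, i != ord0 -> at_distance (mx_graph A) ord0 i 1) :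
  let B : 'cV[R]_n.+1 := delta_mx ord0 ord0 in
  (herdable_ct A B <-> edges_same_sign A) /\
  (herdable_dt A B <-> edges_same_sign A).
Proof.
have star := tree_star_mx hsym htree hdist.
by split; [exact: star_herdable_ct|exact: star_herdable_dt].
Qed.
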